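(* Let $n\in\mathbb{N}$, $n\ge 1$. Any continuous linear functional $x^*$ on $C_{\lim}(\mathbb{R}_+,\mathbb{R}^n)$ can be uniquely represented in the form $$\langle x^*,x(\cdot)\rangle=\int_0^\infty\langle x(t)-x(\infty),d\mu(t)\rangle+\alpha^T x(\infty)=\int_0^\infty\langle x_0(t),d\mu(t)\rangle+\alpha^T x(\infty)\qquad\text{for all } x(\cdot)\in C_{\lim}(\mathbb{R}_+,\mathbb{R}^n),$$ where $x_0(t)=x(t)-x(\infty)$, $\mu=(\mu_1,\dots,\mu_n)$ is a vector of measures $\mu_1,\dots,\mu_n\in\mathscr{M}(\mathbb{R}_+)$ and $\alpha\in\mathbb{R}^n$.
   Context: $\mathbb{R}_+=[0,\infty)$. $C_{\lim}(\mathbb{R}_+,\mathbb{R}^n)$ is the Banach space of all continuous functions $x(\cdot):\mathbb{R}_+\to\mathbb{R}^n$ for which the limit $x(\infty):=\lim_{t\to\infty}x(t)\in\mathbb{R}^n$ exists, with the supremum norm $\|\cdot\|_\infty$. Equivalently, it consists of all functions $x(t)=x_0(t)+a$ with $x_0(\cdot)\in C_0(\mathbb{R}_+,\mathbb{R}^n)$ (continuous functions vanishing at infinity) and $a\in\mathbb{R}^n$; this representation is unique and $a=x(\infty)$. $\mathscr{M}(\mathbb{R}_+)$ is the set of (finite) signed regular Borel measures on $\mathbb{R}_+$, where a signed measure is regular if its total variation is inner regular with respect to compact sets and outer regular with respect to open sets. For a vector of measures, $\int\langle x(t),d\mu(t)\rangle=\sum_{i=1}^n\int x_i(t)\,d\mu_i(t)$.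 *)

(* Defs.v *)
From HB Require Import structures.
From mathcomp Require Import all_boot all_order all_algebra.
From mathcomp Require Import all_classical all_reals all_analysis.
Set Implicit Arguments.
Unset Strict Implicit.
Unset Printing Implicit Defensive.
Import Order.TTheory GRing.Theory Num.Theory.
Import numFieldNormedType.Exports.
Local Open Scope classical_set_scope.
Local Open Scope ring_scope.

Section Rplus.
Context (R : realType).

Definition nonneg_set : set R := [set t | 0 <= t].

Definition Rplus : Type := set_type nonneg_set.

HB.instance Definition _ := Choice.copy Rplus (set_type nonneg_set).
HB.instance Definition _ := PseudoMetric.copy Rplus (set_type nonneg_set).

Definition mkRplus (t : R) (t0 : 0 <= t) : Rplus :=
  exist _ t (@mem_set R nonneg_set t t0).

HB.instance Definition _ := isPointed.Build Rplus (mkRplus (lexx 0)).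

HB.instance Definition _ := Measurable.copy Rplus
  (g_sigma_algebraType (@open Rplus)).

Definition Rplus_infty : set_system Rplus :=
  [set A | exists M : R, forall t : Rplus, M < set_val t -> A t].

Lemma maxr0_ge0 (s : R) : 0 <= Num.max 0 s.
Proof. by rewrite le_max lexx. Qed.

Definition clampR (s : R) : Rplus := mkRplus (maxr0_ge0 s).

Lemma clampRK (t : Rplus) : clampR (set_val t) = t.
Proof.
apply: val_inj => /=; have := set_valP t.
by rewrite /nonneg_set/= => /max_r ->.
Qed.

Lemma clampR_continuous : continuous clampR.
Proof.
apply/continuousP => _ [B oB <-].
rewrite -comp_preimage.
suff : continuous (fun s : R => Num.max 0 s) by move/continuousP; exact.
by move=> s; apply: continuous_max; [exact: cvg_cst|exact: cvg_id].
Qed.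

#[global] Instance Rplus_infty_proper : ProperFilter Rplus_infty.
Proof.
apply: Build_ProperFilter_ex.
  move=> A [M MA]; exists (clampR (M + 1)); apply: MA.
  by rewrite /set_val/= /clampR/= lt_max ltrDl ltr01 orbT.
split.
- by exists 0.
- move=> A B [M MA] [N NB]; exists (Num.max M N) => t.
  by rewrite gt_max => /andP[Mt Nt]; split; [exact: MA|exact: NB].
- by move=> A B AB [M MA]; exists M => t /MA /AB.
Qed.

End Rplus.

Arguments Rplus_infty : clear implicits.

Section Clim.
Context (R : realType) (n : nat).
Local Notation V := 'cV[R]_n.

Definition clim_pred : {pred Rplus R -> V} :=
  fun x => `[< continuous x /\ cvg (x @ Rplus_infty R) >].

Record Clim := MkClim {
  clim_fun :> Rplus R -> V;
  clim_funP : clim_fun \in clim_pred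
}.

HB.instance Definition _ := [isSub for clim_fun].
HB.instance Definition _ := gen_eqMixin Clim.
HB.instance Definition _ := [Choice of Clim by <:].

Lemma clim_predP (x : Rplus R -> V) :
  reflect (continuous x /\ cvg (x @ Rplus_infty R)) (x \in clim_pred).
Proof. exact: asboolP. Qed.

Lemma clim_submod_closed : submod_closed clim_pred.
Proof.
split.
  apply/clim_predP; split.
    by move=> t; exact: (@cvg_cst V 0 (Rplus R) (nbhs t)).
  by apply/cvg_ex; exists 0; exact: (@cvg_cst V 0 (Rplus R) (Rplus_infty R)).
move=> a x y /clim_predP[cx lx] /clim_predP[cy ly]; apply/clim_predP; split.
- by move=> t; exact: (cvgD (cvgZ (cvg_cst _) (cx t)) (cy t)).
- by apply/cvg_ex; eexists; exact: (cvgD (cvgZ (cvg_cst a) lx) ly).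
Qed.

HB.instance Definition _ :=
  GRing.isSubmodClosed.Build _ _ clim_pred clim_submod_closed.
HB.instance Definition _ := [SubChoice_isSubLmodule of Clim by <:].

Definition clim_lim (x : Clim) : V := lim (x @ Rplus_infty R).

(* Inside the supremum, `|x t| is the max norm of 'cV[R]_n. *)
Definition clim_norm (x : Clim) : R := sup (range (fun t => `|x t|)).

Lemma clim_bounded (x : Clim) : has_sup (range (fun t => `|x t|)).
Proof.
split; first by exists `|x point|, point.
have /clim_predP[cx lx] := clim_funP x.
have [M HM] : exists M : R, forall t, M < set_val t ->
    `|x t| <= `|clim_lim x| + 1.
  have /cvgrPdist_lt/(_ 1 ltr01)[M HM] := lx; exists M => t /HM.
  rewrite -/(clim_lim x) => /ltW; rewrite distrC => H.
  by rewrite -lerBlDl (le_trans _ H)// lerB_dist.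
have : compact ((fun s => x (clampR s)) @` `[0, M]).
  apply: continuous_compact; last exact: segment_compact.
  apply: continuous_subspaceT => s.
  by apply: continuous_comp; [exact: clampR_continuous|exact: cx].
move=> /compact_bounded[B [_ HB]].
exists (Num.max (B + 1) (`|clim_lim x| + 1)) => _ [t _ <-].
rewrite le_max; have [tM|Mt] := leP (set_val t) M; last first.
  by rewrite HM ?orbT.
rewrite (HB (B + 1)) ?ltrDl//; exists (set_val t).
  by rewrite /= in_itv/= tM andbT; exact: (set_valP t).
by rewrite clampRK.
Qed.

Lemma clim_norm_ub (x : Clim) t : `|x t| <= clim_norm x.
Proof. by apply: ub_le_sup; [exact: (clim_bounded x).2|exists t]. Qed.

Lemma clim_norm_le (x : Clim) (c : R) :
  (forall t, `|x t| <= c) -> clim_norm x <= c.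
Proof.
move=> xc; apply: ge_sup; first exact: (clim_bounded x).1.
by move=> _ [t _ <-].
Qed.

Lemma clim_normD (x y : Clim) : clim_norm (x + y) <= clim_norm x + clim_norm y.
Proof.
apply: clim_norm_le => t.
by rewrite (le_trans (ler_normD (x t) (y t)))// lerD// clim_norm_ub.
Qed.

Lemma clim_normZ (a : R) (x : Clim) : clim_norm (a *: x) = `|a| * clim_norm x.
Proof.
have leZ b (y : Clim) : clim_norm (b *: y) <= `|b| * clim_norm y.
  apply: clim_norm_le => t.
  by rewrite (_ : (b *: y) t = b *: y t)// normrZ ler_wpM2l// clim_norm_ub.
apply/eqP; rewrite eq_le leZ/=.
have [->|a0] := eqVneq a 0.
  by rewrite normr0 mul0r (le_trans _ (clim_norm_ub _ point)).
rewrite -ler_pdivlMl ?normr_gt0// -normfV.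
by rewrite (le_trans _ (leZ _ _))// scalerA mulVf// scale1r.
Qed.

Lemma clim_norm_eq0 (x : Clim) : clim_norm x = 0 -> x = 0.
Proof.
move=> x0; apply/val_inj/funext => t /=; apply/eqP.
by rewrite -normr_le0 -x0 clim_norm_ub.
Qed.

HB.instance Definition _ :=
  Lmodule_isNormed.Build R Clim clim_normD clim_normZ clim_norm_eq0.

End Clim.

Section signed_measures.
Context (d : measure_display) (T : measurableType d) (R : realType).
Implicit Types mu : {charge set T -> \bar R}.

(* Jordan decompositions, total variation and integrals do not depend (on
   measurable sets) on the choice of the Hahn decomposition. *)
Definition hahn_pos mu : set T := projT1 (cid (Hahn_decomposition mu)).

Definition hahn_neg mu : set T :=
  projT1 (cid (projT2 (cid (Hahn_decomposition mu)))).

Definition hahnP mu : hahn_decomposition mu (hahn_pos mu) (hahn_neg mu) :=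
  projT2 (cid (projT2 (cid (Hahn_decomposition mu)))).

Definition total_variation mu : set T -> \bar R := charge_variation (hahnP mu).

Definition charge_integral mu (f : T -> R) : R :=
  \int[jordan_pos (hahnP mu)]_t f t - \int[jordan_neg (hahnP mu)]_t f t.

End signed_measures.

Section representation.
Context (R : realType) (n : nat).

Definition regular_charge (mu : {charge set (Rplus R) -> \bar R}) : Prop :=
  forall A : set (Rplus R), measurable A ->
    total_variation mu A =
      ereal_sup [set total_variation mu K | K in [set K | compact K /\ K `<=` A]]
    /\
    total_variation mu A =
      ereal_inf [set total_variation mu U | U in [set U | open U /\ A `<=` U]].

Definition vector_integral (mu : 'I_n -> {charge set (Rplus R) -> \bar R})
    (x : Rplus R -> 'cV[R]_n) : R :=
  \sum_(i < n) charge_integral (mu i) (fun t => x t i ord0).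

Definition clim_vanishing (x : Clim R n) : Rplus R -> 'cV[R]_n :=
  fun t => x t - clim_lim x.

Definition represents (mu : 'I_n -> {charge set (Rplus R) -> \bar R})
    (alpha : 'cV[R]_n) (F : Clim R n -> R) : Prop :=
  forall x : Clim R n,
    F x = vector_integral mu (fun t => x t - clim_lim x)
          + (alpha^T *m clim_lim x) ord0 ord0
    /\
    vector_integral mu (fun t => x t - clim_lim x)
      + (alpha^T *m clim_lim x) ord0 ord0
    = vector_integral mu (clim_vanishing x)
      + (alpha^T *m clim_lim x) ord0 ord0.

End representation.

(* Main.v *)
Require Import Defs.
From HB Require Import structures.
From mathcomp Require Import all_boot all_order all_algebra.
From mathcomp Require Import all_classical all_reals all_analysis.
From mathcomp Require Import measurable_realfun ring lra.
Set Implicit Arguments.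
Unset Strict Implicit.
Unset Printing Implicit Defensive.
Import Order.TTheory GRing.Theory Num.Theory.
Import numFieldNormedType.Exports.
Local Open Scope classical_set_scope.
Local Open Scope ring_scope.

(** A function with a limit at infinity splits as the sum of a constant and of
    its coordinates, which are scalar functions vanishing at infinity
    ([clim_decomposition]).  On the constants the functional is given by the
    vector [alpha]; on the vanishing functions of each coordinate it is a
    bounded linear functional, and the theorem becomes the Riesz representation
    theorem for scalar functions on the half-line ([riesz_vanishing]).

    On the half-line this theorem can be proved with distribution functions.  A
    bounded functional is the difference of two functionals that are additive
    and nonnegative on the nonnegative functions ([positive_part_additive],
    [negative_part_additive]).  Let [Q] be such a positive functional.  The test
    functions are the ramps: [ramp s d] is 1 up to [s], 0 after [s + d], and
    affine in between.  The infimum [ramp_inf Q s] over [d > 0] of the values of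
    [Q] at [ramp (s + d) d] is nondecreasing, right-continuous and bounded in
    [s], hence is the distribution function [G] of a finite measure [mu].

    The functional [Q] and the integral against [mu] agree on ramps
    ([sandwich_unique]).  Indeed both satisfy the coarse estimate
    [G (s - d) <= Q (ramp s d) <= G (s + d)].  Moreover [m] times a ramp of
    width [d] is a sum of [m] ramps of width [d / m] that descend one after the
    other; summing the coarse estimates telescopes, so that [m] times the
    difference of the two values stays bounded.  Linear interpolation shows that
    the combinations of ramps are uniformly dense among the vanishing functions
    ([ramp_approximation]), so that the representation extends from ramps to all
    of them by continuity.

    Ramps also give uniqueness: as the width tends to 0 they decrease to the
    indicator of an initial segment, so their integrals determine a finite
    measure ([ramp_measure_unique]), and, through Jordan decompositions, a
    charge ([charge_unique]).  Finally every finite Borel measure on the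
    half-line is regular ([finite_measure_regular]), because the sets that can
    be enclosed between a closed and an open set of almost the same measure form
    a sigma-algebra containing the open sets, and closed sets are exhausted by
    their intersections with segments. *)

(** * Functions vanishing at infinity and ramps *)

Section vanishing.
Context {R : realType}.
Implicit Types (f g : Rplus R -> R) (a s d : R) (t : Rplus R).

Definition vanishing f := continuous f /\ f @ Rplus_infty R --> (0 : R).

Lemma vanishing0 : vanishing (fun=> 0).
Proof.
split => [t|]; first exact: (@cvg_cst R^o 0 (Rplus R) (nbhs t)).
exact: (@cvg_cst R^o 0 (Rplus R) (Rplus_infty R)).
Qed.

Lemma vanishingD f g :
  vanishing f -> vanishing g -> vanishing (fun t => f t + g t).
Proof.
move=> [cf f0] [cg g0]; split.
  by move=> t; exact: (cvgD (cf t) (cg t)).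
by rewrite -[X in _ --> X]addr0; exact: cvgD.
Qed.

Lemma vanishingZ a f : vanishing f -> vanishing (fun t => a * f t).
Proof.
move=> [cf f0]; split.
  by move=> t; exact: (cvgM (cvg_cst a) (cf t)).
by rewrite -[X in _ --> X](mulr0 a); apply: cvgM => //; exact: cvg_cst.
Qed.

Lemma vanishingB f g :
  vanishing f -> vanishing g -> vanishing (fun t => f t - g t).
Proof.
move=> vf vg; rewrite (_ : (fun t => _) = (fun t => f t + -1 * g t)).
  exact: vanishingD vf (vanishingZ (-1) vg).
by apply/funext => t; rewrite mulN1r.
Qed.

Lemma vanishing_sum (F : nat -> Rplus R -> R) m :
  (forall k, vanishing (F k)) -> vanishing (fun t => \sum_(k < m) F k t).
Proof.
move=> vF; elim: m => [|m IHm].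
  by under eq_fun do rewrite big_ord0; exact: vanishing0.
by under eq_fun do rewrite big_ord_recr/=; exact: vanishingD.
Qed.

Lemma vanishing_min f g : (forall t, 0 <= f t) -> (forall t, 0 <= g t) ->
  vanishing f -> vanishing g -> vanishing (fun t => Num.min (f t) (g t)).
Proof.
move=> f0 g0 [cf fl] [cg gl]; split.
  by move=> t; apply: continuous_min; [exact: cf|exact: cg].
apply: (squeeze_cvgr _ (cvg_cst 0) fl).
by apply: nearW => t; rewrite le_min f0 g0 ge_min lexx.
Qed.

Lemma vanishing_small f (e : R) : vanishing f -> 0 < e ->
  exists2 M : R, 0 <= M & forall t, M < set_val t -> `|f t| < e.
Proof.
move=> [_ f0] e0; have /cvgrPdist_lt/(_ _ e0)[M HM] := f0.
exists (Num.max 0 M) => [|t]; first by rewrite le_max lexx.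
by rewrite gt_max => /andP[_ /HM]; rewrite sub0r normrN.
Qed.

Lemma vanishing_bounded f : vanishing f -> exists c, forall t, `|f t| <= c.
Proof.
move=> vf; have [M M0 HM] := vanishing_small vf ltr01.
have : compact ((fun s => f (clampR s)) @` `[0, M]).
  apply: continuous_compact; last exact: segment_compact.
  apply: continuous_subspaceT => s.
  by apply: continuous_comp; [exact: clampR_continuous|exact: vf.1].
move=> /compact_bounded[B [_ HB]].
exists (Num.max (B + 1) 1) => t; rewrite le_max.
have [tM|Mt] := leP (set_val t) M; last by rewrite (ltW (HM t Mt)) orbT.
rewrite (HB (B + 1)) ?ltrDl//; exists (set_val t).
  by rewrite /= in_itv/= tM andbT; exact: (set_valP t).
by rewrite clampRK.
Qed.

Definition clamp a : R := Num.min 1 (Num.max 0 a).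

Definition ramp s d t := clamp ((s + d - set_val t) / d).

(* The inner maximum is split first: lra needs the test of the outer minimum to
   be linear. *)
Local Ltac clamp_lra :=
  rewrite /clamp/Num.max; repeat (case: ifPn; rewrite -?leNgt => ?);
  rewrite /Num.min; repeat (case: ifPn; rewrite -?leNgt => ?); lra.

Lemma clamp_itv a : 0 <= clamp a <= 1.
Proof. by clamp_lra. Qed.

Lemma le_clamp a b : a <= b -> clamp a <= clamp b.
Proof. by clamp_lra. Qed.

Lemma clamp_ge1 a : 1 <= a -> clamp a = 1.
Proof. by clamp_lra. Qed.

Lemma clamp_le0 a : a <= 0 -> clamp a = 0.
Proof. by clamp_lra. Qed.

(** A slope from 0 to [m] is a staircase of [m] unit slopes: adding the unit
    steps one at a time, at most one of them is neither 0 nor 1. *)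
Lemma clamp_sum m (v : R) :
  m%:R * clamp ((v + m%:R) / m%:R) = \sum_(k < m) clamp (v + k%:R + 1).
Proof.
elim: m => [|m IHm]; first by rewrite big_ord0 mul0r.
rewrite big_ord_recr/= -IHm -[in LHS]natr1.
case: m {IHm} => [|m].
  by rewrite mulr0n mul0r !(add0r, addr0) mul1r divr1.
have m0 : 0 < m.+1%:R :> R by [].
move: (m.+1%:R : R) m0 => x x0.
(* Clearing the denominators leaves piecewise linear terms. *)
have xclamp y u : 0 < y -> y * clamp (u / y) = Num.min y (Num.max 0 u).
  move=> y0. rewrite /clamp minr_pMr ?ltW// mulr1 maxr_pMr ?ltW// mulr0.
  by rewrite mulrCA divff ?mulr1 ?gt_eqF.
rewrite !xclamp//; last lra.
clamp_lra.
Qed.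

Lemma ramp_itv s d t : 0 <= ramp s d t <= 1.
Proof. exact: clamp_itv. Qed.

Lemma ramp1 s d t : 0 < d -> set_val t <= s -> ramp s d t = 1.
Proof. by move=> d0 ts; rewrite /ramp clamp_ge1// ler_pdivlMr// mul1r; lra. Qed.

Lemma ramp0 s d t : 0 < d -> s + d <= set_val t -> ramp s d t = 0.
Proof. by move=> d0 ts; rewrite /ramp clamp_le0// ler_pdivrMr// mul0r; lra. Qed.

(** Wherever the first ramp is positive, the second one is still 1. *)
Lemma le_ramp s d s' d' t : 0 < d -> 0 < d' -> s + d <= s' ->
  ramp s d t <= ramp s' d' t.
Proof.
move=> d0 d'0 ss'; have [ts'|s't] := leP (set_val t) s'.
  by rewrite [leRHS]ramp1//; case/andP: (ramp_itv s d t).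
by rewrite ramp0 ?(le_trans ss' (ltW s't))//; case/andP: (ramp_itv s' d' t).
Qed.

Lemma le_rampl s s' d t : 0 < d -> s <= s' -> ramp s d t <= ramp s' d t.
Proof.
by move=> d0 ss'; apply: le_clamp; rewrite ler_pM2r ?invr_gt0//; lra.
Qed.

Lemma vanishing_ramp s d : 0 < d -> vanishing (ramp s d).
Proof.
move=> d0; split.
  have cu : continuous (fun t : Rplus R => (s + d - set_val t) / d).
    move=> t; have ct : set_val @ t --> set_val t by exact: initial_continuous.
    exact: (cvgM (cvgB (cvg_cst (s + d)) ct) (cvg_cst d^-1)).
  have c0 (a : R) : continuous (fun _ : Rplus R => a : R^o).
    by move=> t; exact: (@cvg_cst R^o a _ (nbhs t)).
  move=> t; apply: (continuous_min (c0 1 t)).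
  exact: (continuous_max (c0 0 t) (cu t)).
apply/cvgrPdist_lt => e e0; exists (s + d) => t /ltW st.
by rewrite ramp0// subr0 normr0.
Qed.

Lemma ramp_sum s d m t : 0 < d ->
  m%:R * ramp s (d * m%:R) t = \sum_(k < m) ramp (s + d * k%:R) d t.
Proof.
move=> d0; case: m => [|m]; first by rewrite mul0r big_ord0.
transitivity (m.+1%:R * clamp (((s - set_val t) / d + m.+1%:R) / m.+1%:R)).
  congr (_ * clamp _); field.
  by rewrite (gt_eqF d0) andbT nat1r pnatr_eq0.
rewrite clamp_sum; apply: eq_bigr => k _; congr clamp; field.
by rewrite gt_eqF.
Qed.

End vanishing.

(** * Positive and bounded functionals, Riesz decomposition *)

Section functionals.
Context {R : realType}.
Implicit Types (L Q : (Rplus R -> R) -> R) (f g : Rplus R -> R) (C : R).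

Definition nneg f := forall t, 0 <= f t.

(** Positive functionals are only considered on the cone of nonnegative
    functions: the positive part of a functional is naturally defined there, and
    homogeneity for integers, which follows from additivity, is enough. *)
Record positive_additive Q : Prop := PositiveAdditive {
  pos_ge0 : forall f, vanishing f -> nneg f -> 0 <= Q f ;
  posD : forall f g, vanishing f -> vanishing g -> nneg f -> nneg g ->
    Q (fun t => f t + g t) = Q f + Q g }.

(** The bound is stated with an upper bound of the function instead of its
    supremum norm, which avoids suprema. *)
Record bounded_linear C L : Prop := BoundedLinear {
  blin : forall a f g, vanishing f -> vanishing g ->
    L (fun t => a * f t + g t) = a * L f + L g ;
  bbound : forall f c, vanishing f -> (forall t, `|f t| <= c) ->
    `|L f| <= C * c }.

Lemma le_pos Q f g : positive_additive Q -> vanishing f -> vanishing g ->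
  nneg f -> (forall t, f t <= g t) -> Q f <= Q g.
Proof.
move=> pQ vf vg f0 fg.
have gf0 : nneg (fun t => g t - f t) by move=> t; rewrite subr_ge0.
rewrite (_ : g = (fun t => f t + (g t - f t))); last first.
  by apply/funext => t; rewrite addrC subrK.
by rewrite (posD pQ)// ?lerDl ?(pos_ge0 pQ)//; exact: vanishingB.
Qed.

Lemma pos0 Q : positive_additive Q -> Q (fun=> 0) = 0.
Proof.
move=> pQ; have := posD pQ vanishing0 vanishing0 (fun=> lexx 0) (fun=> lexx 0).
under eq_fun do rewrite addr0.
by move=> Q0; apply: (addrI (Q (fun=> 0))); rewrite -Q0 addr0.
Qed.

Lemma pos_sum Q (F : nat -> Rplus R -> R) m : positive_additive Q ->
  (forall k, vanishing (F k)) -> (forall k, nneg (F k)) ->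
  Q (fun t => \sum_(k < m) F k t) = \sum_(k < m) Q (F k).
Proof.
move=> pQ vF F0; elim: m => [|m IHm].
  by under eq_fun do rewrite big_ord0; rewrite big_ord0 pos0.
under eq_fun do rewrite big_ord_recr/=.
rewrite (posD pQ) ?IHm ?big_ord_recr//; first exact: vanishing_sum.
by move=> t; apply: sumr_ge0 => k _; exact: F0.
Qed.

Lemma pos_natmul Q f m : positive_additive Q -> vanishing f -> nneg f ->
  Q (fun t => m%:R * f t) = m%:R * Q f.
Proof.
move=> pQ vf f0; rewrite (_ : (fun t => _) = (fun t => \sum_(k < m) f t)).
  by rewrite (@pos_sum _ (fun=> f))// sumr_const card_ord mulr_natl.
by apply/funext => t; rewrite sumr_const card_ord mulr_natl.
Qed.

Section riesz_decomposition.
Variables (C : R) (L : (Rplus R -> R) -> R).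
Hypothesis bL : bounded_linear C L.

Let minorant_values f := [set L g | g in
  [set g | vanishing g /\ (nneg g /\ forall t, g t <= f t)]].

(** The positive part in the order dual: the supremum of [L] on the
    nonnegative functions below [f]. *)
Definition positive_part f := sup (minorant_values f).

Let LD f g : vanishing f -> vanishing g -> L (fun t => f t + g t) = L f + L g.
Proof.
move=> vf vg; rewrite -[L f]mul1r -(blin bL)//.
by under eq_fun do rewrite -[f _]mul1r.
Qed.

Let minorants_ub f c : nneg f -> (forall t, f t <= c) ->
  ubound (minorant_values f) (C * c).
Proof.
move=> f0 fc _ [g [vg [g0 gf]] <-]; rewrite (le_trans (ler_norm _))//.
by apply: (bbound bL) => // t; rewrite ger0_norm// (le_trans (gf t)).
Qed.

Let minorants_sup f : vanishing f -> nneg f -> has_sup (minorant_values f).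
Proof.
move=> vf f0; split.
  by exists (L (fun=> 0)), (fun=> 0) => //; split; [exact: vanishing0|split].
have [c fc] := vanishing_bounded vf.
exists (C * c); apply: minorants_ub => // t.
exact: le_trans (ler_norm _) (fc t).
Qed.

Lemma positive_part_ge f g : vanishing f -> vanishing g -> nneg g ->
  (forall t, g t <= f t) -> L g <= positive_part f.
Proof.
move=> vf vg g0 gf; apply: ub_le_sup; last by exists g.
by apply: (minorants_sup vf _).2 => t; exact: le_trans (g0 t) (gf t).
Qed.

Lemma positive_part_le f c : vanishing f -> nneg f -> (forall t, f t <= c) ->
  positive_part f <= C * c.
Proof.
move=> vf f0 fc; apply: ge_sup; first exact: (minorants_sup vf f0).1.
exact: minorants_ub.
Qed.

(** Superadditivity is immediate by adding minorants.  Conversely, a minorant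
    [h] of [f + g] is the sum of the minorant [min h f] of [f] and of
    [h - min h f], which is a minorant of [g]. *)
Lemma positive_part_additive : positive_additive positive_part.
Proof.
have L0 : L (fun=> 0) = 0.
  have /(_ 0) := bbound bL vanishing0; rewrite mulr0 normr0 => H.
  by apply/eqP; rewrite -normr_le0 H.
split=> [f vf f0|f g vf vg f0 g0].
  by rewrite -L0; apply: positive_part_ge => //; exact: vanishing0.
have vfg := vanishingD vf vg.
have fg0 : nneg (fun t => f t + g t) by move=> t; rewrite addr_ge0.
apply/eqP; rewrite eq_le; apply/andP; split.
  apply: ge_sup; first exact: (minorants_sup vfg fg0).1.
  move=> _ [h [vh [h0 hfg]] <-].
  pose h1 t := Num.min (h t) (f t); pose h2 t := h t - h1 t.
  have vh1 : vanishing h1 by exact: vanishing_min.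
  have vh2 : vanishing h2 by exact: vanishingB.
  rewrite (_ : h = (fun t => h1 t + h2 t)); last first.
    by apply/funext => t; rewrite /h2 addrC subrK.
  rewrite LD// lerD//; apply: positive_part_ge => // t.
  - by rewrite /h1 le_min h0 f0.
  - by rewrite /h1 ge_min lexx orbT.
  - by rewrite /h2 subr_ge0 /h1 ge_min lexx.
  - rewrite /h2 /h1; have [_|_] := leP (h t) (f t); first by rewrite subrr.
    by rewrite lerBlDl hfg.
rewrite -lerBrDr; apply: ge_sup; first exact: (minorants_sup vf f0).1.
move=> _ [h [vh [h0 hf]] <-]; rewrite lerBrDr -lerBrDl.
apply: ge_sup; first exact: (minorants_sup vg g0).1.
move=> _ [k [vk [k0 kg]] <-]; rewrite lerBrDl -LD//.
apply: positive_part_ge => // [|t|t]; first exact: vanishingD.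
- by rewrite addr_ge0.
- by rewrite lerD.
Qed.

Lemma negative_part_additive :
  positive_additive (fun f => positive_part f - L f).
Proof.
split=> [f vf f0|f g vf vg f0 g0].
  by rewrite subr_ge0 positive_part_ge.
by rewrite (posD positive_part_additive)// LD// opprD addrACA.
Qed.

Lemma negative_part_le f c : vanishing f -> nneg f -> (forall t, f t <= c) ->
  positive_part f - L f <= 2 * C * c.
Proof.
move=> vf f0 fc; have H1 := positive_part_le vf f0 fc.
have /ler_normlP[H2 _] : `|L f| <= C * c.
  by apply: (bbound bL) => // t; rewrite ger0_norm.
by rewrite -mulrA mulr_natl mulr2n lerD.
Qed.

End riesz_decomposition.

End functionals.

(** * Positive functionals on ramps *)

Section ramps.
Context {R : realType}.
Implicit Types (Q : (Rplus R -> R) -> R) (G : R -> R).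

Lemma ramp_nneg (s d : R) : nneg (ramp s d).
Proof. by move=> t; case/andP: (ramp_itv s d t). Qed.

(** A ramp of width [d] is the average of [m.+1] shifted ramps of width
    [d / m.+1]; counting from [m.+1] keeps the width nonzero. *)
Lemma ramp_partition Q (s d : R) m : positive_additive Q -> 0 < d ->
  m.+1%:R * Q (ramp s d) =
  \sum_(k < m.+1) Q (ramp (s + d / m.+1%:R * k%:R) (d / m.+1%:R)).
Proof.
move=> pQ d0; have e0 : 0 < d / m.+1%:R by rewrite divr_gt0.
pose F k := ramp (s + d / m.+1%:R * k%:R) (d / m.+1%:R).
rewrite -(pos_natmul _ pQ); last exact: ramp_nneg; last exact: vanishing_ramp.
rewrite -(@pos_sum _ _ F)//; last first.
- by move=> k; exact: ramp_nneg.
- by move=> k; exact: vanishing_ramp.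
congr Q; apply/funext => t; rewrite -ramp_sum//.
by rewrite mulfVK// pnatr_eq0.
Qed.

(** The coarse control of a functional on ramps by a distribution function.
    The margin [d] on the left makes it hold for [ramp_inf], whose infimum runs
    over ramps starting strictly to the right. *)
Definition sandwich Q G :=
  forall s d, 0 < d -> G (s - d) <= Q (ramp s d) <= G (s + d).

Lemma sandwich_partition Q G (s d : R) m (e := d / m.+1%:R)
    (g := fun k => G (s - e + e * k%:R)) :
  positive_additive Q -> 0 < d -> sandwich Q G ->
  \sum_(k < m.+1) g k <= m.+1%:R * Q (ramp s d) <= \sum_(k < m.+1) g k.+2.
Proof.
move=> pQ d0 QG; have e0 : 0 < e by rewrite divr_gt0.
rewrite ramp_partition//; apply/andP; split; apply: ler_sum => k _.
  case/andP: (QG (s + e * k%:R) _ e0) => + _.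
  by rewrite /g addrAC.
case/andP: (QG (s + e * k%:R) _ e0) => _.
by rewrite /g (_ : s - e + _ = s + e * k%:R + e)// -2!natr1; ring.
Qed.

(** Cutting a ramp into [m.+1] pieces and applying the sandwich to each of them
    bounds [m.+1] times the difference of the two values by telescoping sums,
    hence by twice the bound of [G], whatever [m]. *)
Lemma sandwich_unique Q1 Q2 G (s d B : R) :
  positive_additive Q1 -> positive_additive Q2 ->
  sandwich Q1 G -> sandwich Q2 G -> (forall u, 0 <= G u <= B) ->
  0 < d -> Q1 (ramp s d) = Q2 (ramp s d).
Proof.
wlog lt12 : Q1 Q2 / Q1 (ramp s d) < Q2 (ramp s d) => [wH|] p1 p2 s1 s2 GB d0.
  have [lt12|lt21|//] := ltgtP (Q1 (ramp s d)) (Q2 (ramp s d)).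
    exact: (wH Q1 Q2).
  by apply/esym; exact: (wH Q2 Q1).
set x := Q2 (ramp s d) - Q1 (ramp s d).
have x0 : 0 < x by rewrite subr_gt0.
have B0 : 0 <= B by have /andP[/le_trans] := GB 0; exact.
pose m := Num.bound ((B + B) / x).
pose e := d / m.+1%:R.
pose g k := G (s - e + e * k%:R).
have /andP[H1 _] := sandwich_partition s m p1 d0 s1.
have /andP[_ H2] := sandwich_partition s m p2 d0 s2.
have : m.+1%:R * x <= \sum_(k < m.+1) (g k.+2 - g k).
  by rewrite sumrB mulrBr lerB.
have tel (h : nat -> R) : (forall k, 0 <= h k <= B) ->
    \sum_(k < m.+1) (h k.+1 - h k) <= B.
  move=> hB; rewrite -(big_mkord xpredT (fun k => h k.+1 - h k)).
  rewrite telescope_sumr//.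
  by have /andP[? _] := hB 0%N; have /andP[_ ?] := hB m.+1; lra.
(* The margin of the sandwich on both sides makes the difference of the bounds a
   jump over two grid points, that is, the sum of two telescoping sums. *)
have -> : \sum_(k < m.+1) (g k.+2 - g k) =
    \sum_(k < m.+1) (g k.+2 - g k.+1) + \sum_(k < m.+1) (g k.+1 - g k).
  by rewrite -big_split/=; apply: eq_bigr => k _; ring.
move=> /le_trans/(_ (lerD (tel (fun k => g k.+1) _) (tel g _))).
move=> /(_ (fun k => GB _) (fun k => GB _)).
rewrite -ler_pdivlMr// leNgt => /negP[].
rewrite (lt_trans (archi_boundP _))//.
  by apply: divr_ge0; [exact: addr_ge0|exact: ltW].
by rewrite ltr_nat.
Qed.

Variables (Q : (Rplus R -> R) -> R) (C : R).
Hypotheses (pQ : positive_additive Q)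
  (Qle : forall f c, vanishing f -> nneg f -> (forall t, f t <= c) ->
    Q f <= C * c).

Let ramps (s : R) := [set Q (ramp (s + d) d) | d in [set d | 0 < d]].

(** The distribution function of the measure to be constructed.  Starting the
    ramps at [s + d] instead of [s] makes right-continuity immediate: a ramp
    that is nearly optimal for [s] is still admissible, up to narrowing it, for
    points slightly to the right of [s]. *)
Definition ramp_inf (s : R) : R := inf (ramps s).

Let ramp_has_inf (s : R) : has_inf (ramps s).
Proof.
split; first by exists (Q (ramp (s + 1) 1)), 1 => //=.
exists 0 => _ [d /= d0 <-]; apply: (pos_ge0 pQ); last exact: ramp_nneg.
exact: vanishing_ramp.
Qed.

Let ramp_inf_le (s d : R) : 0 < d -> ramp_inf s <= Q (ramp (s + d) d).
Proof. by move=> d0; apply: ge_inf; [exact: (ramp_has_inf s).2|exists d]. Qed.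

Let Q_le_ramp (s d s' d' : R) : 0 < d -> 0 < d' ->
  s + d <= s' -> Q (ramp s d) <= Q (ramp s' d').
Proof.
move=> d0 d'0 ss'; apply: (le_pos pQ); try exact: vanishing_ramp.
  exact: ramp_nneg.
by move=> t; apply: le_ramp.
Qed.

Lemma ramp_inf_sandwich : sandwich Q ramp_inf.
Proof.
move=> s d d0; apply/andP; split.
  by have := ramp_inf_le (s - d) d0; rewrite subrK.
apply: lb_le_inf; first exact: (ramp_has_inf (s + d)).1.
by move=> _ [e /= e0 <-]; apply: Q_le_ramp => //; lra.
Qed.

Lemma ramp_inf_nondecreasing : nondecreasing ramp_inf.
Proof.
move=> s s' ss'; apply: lb_le_inf; first exact: (ramp_has_inf s').1.
move=> _ [d /= d0 <-]; apply: (le_trans (ramp_inf_le s d0)).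
apply: (le_pos pQ); try exact: vanishing_ramp; first exact: ramp_nneg.
by move=> t; apply: le_rampl => //; lra.
Qed.

Lemma ramp_inf_right_continuous : right_continuous ramp_inf.
Proof.
move=> s; apply/cvgrPdist_lt => e e0.
have [_ [d /= d0 <-] Qd] := inf_adherent e0 (ramp_has_inf s).
exists (d / 2) => /=; first by rewrite divr_gt0.
move=> u /= su lt_su; rewrite distrC ger0_norm; last first.
  by rewrite subr_ge0; apply: ramp_inf_nondecreasing; exact: ltW.
rewrite ltrBlDl (le_lt_trans _ Qd)//.
rewrite ltr0_norm ?subr_lt0// opprB in su.
(* Width [d / 4] fits: [u < s + d / 2], and the shifted ramp ends at
   [u + d / 2], before the nearly optimal ramp starts at [s + d]. *)
have d40 : 0 < d / 4 by rewrite divr_gt0.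
by apply: (le_trans (ramp_inf_le u d40)); apply: Q_le_ramp => //; lra.
Qed.

Lemma ramp_inf_itv (s : R) : 0 <= ramp_inf s <= C.
Proof.
apply/andP; split.
  apply: lb_le_inf; first exact: (ramp_has_inf s).1.
  move=> _ [d /= d0 <-]; apply: (pos_ge0 pQ); last exact: ramp_nneg.
  exact: vanishing_ramp.
apply: (le_trans (ramp_inf_le s ltr01)).
rewrite -[C]mulr1; apply: Qle => [||t]; first exact: vanishing_ramp.
  exact: ramp_nneg.
by case/andP: (ramp_itv (s + 1) 1 t).
Qed.

Lemma ramp_inf_lt0 (s : R) : s < 0 -> ramp_inf s = 0.
Proof.
move=> s0; apply/eqP; rewrite eq_le (andP (ramp_inf_itv s)).1 andbT.
have d0 : 0 < - s / 2 by rewrite divr_gt0 ?oppr_gt0.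
apply: (le_trans (ramp_inf_le s d0)).
rewrite (_ : ramp _ _ = fun=> 0) ?pos0//.
apply/funext => t; rewrite ramp0//.
by have : 0 <= set_val t := set_valP t; lra.
Qed.

End ramps.

(** * Borel sets of the half-line and Stieltjes measures *)

Section borel.
Context {R : realType}.

Lemma open_Rplus_measurable (U : set (Rplus R)) : open U -> measurable U.
Proof. by move=> oU; exact: sub_sigma_algebra. Qed.

Lemma closed_Rplus_measurable (A : set (Rplus R)) : closed A -> measurable A.
Proof.
move=> cA; rewrite -[A]setCK; apply: measurableC.
by apply: open_Rplus_measurable; exact: closed_openC.
Qed.

Lemma continuous_Rplus_measurable (f : Rplus R -> R) :
  continuous f -> measurable_fun setT f.
Proof.
move=> /continuousP cf; apply: (measurability _ (RGenOpens.measurableE R)).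
move=> _ [_ [x [y ->]] <-]; rewrite setTI; apply: open_Rplus_measurable.
by apply: cf; exact: interval_open.
Qed.

Lemma measurable_set_val : measurable_fun setT (set_val : Rplus R -> R).
Proof. by apply: continuous_Rplus_measurable; exact: initial_continuous. Qed.

Lemma measurable_clampR :
  measurable_fun setT (@clampR R : measurableTypeR R -> Rplus R).
Proof.
apply: (@measurability _ _ _ _ _ _ (@open (Rplus R))) => // _ [U oU <-].
rewrite setTI; apply: open_measurable.
by move/continuousP : (@clampR_continuous R); exact.
Qed.

Definition below (s : R) : set (Rplus R) := [set t | set_val t <= s].

Lemma measurable_below s : measurable (below s).
Proof.
have := measurable_set_val measurableT (measurable_itv `]-oo, s]).
rewrite setTI (_ : _ @^-1` _ = below s)//.
Qed.

End borel.

Lemma pushforward_finite d d' (T1 : measurableType d) (T2 : measurableType d')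
    (R : realType) (m : {finite_measure set T1 -> \bar R}) (f : T1 -> T2) :
  measurable_fun setT f ->
  exists mu : {finite_measure set T2 -> \bar R},
    mu = pushforward m f :> (set T2 -> \bar R).
Proof.
move=> mf; have mfin : fin_num_fun (pushforward m f).
  move=> A mA; apply: fin_num_measure.
  by rewrite -[X in measurable X]setTI; exact: mf.
pose mu0 : {measure set T2 -> \bar R} :=
  measure_function_pushforward__canonical__measure_function_Measure m mf.
pose F := @Measure_isFinite.Build _ _ _ mu0 mfin.
pose mu := HB.pack_for {finite_measure set T2 -> \bar R}
  (pushforward m f) mu0 F.
by exists (mu mf).
Qed.

Section cumulative.
Context {R : realType} (G : R -> R) (C : R).
Hypotheses (ndG : nondecreasing G) (rcG : right_continuous G)
  (GC : forall s, 0 <= G s <= C) (G0 : forall s, s < 0 -> G s = 0).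

#[local] HB.instance Definition _ := isCumulative.Build R _ R G ndG rcG.

Let m := lebesgue_stieltjes_measure G.

Let m_itv (a b : R) : a <= b -> m `]a, b] = (G b - G a)%:E.
Proof.
move=> ab; rewrite /m /lebesgue_stieltjes_measure /measure_extension/=.
by rewrite measurable_mu_extE/= ?wlength_itv_bnd//; exact: is_ocitv.
Qed.

Let m_ray (s : R) : m `]-oo, s] = (G s)%:E.
Proof.
rewrite itvNybndEbigcup.
have : m `]-n%:R, s] @[n --> \oo] --> m (\bigcup_n `]-n%:R, s]%classic).
  apply: nondecreasing_cvg_mu => //; first exact: bigcup_measurable.
  by move=> *; apply/subsetPset/subset_itv; rewrite leBSide//= lerN2 ler_nat.
move=> /cvg_unique; apply => //.
apply: cvg_near_cst; near=> n.
(* For [n] large the left end point is negative, where [G] is 0. *)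
have n0 : - n%:R < 0 :> R.
  by rewrite oppr_lt0 ltr0n; near: n; exact: nbhs_infty_gt.
have ns : - n%:R <= s by rewrite lerNl; near: n; exact: nbhs_infty_ger.
by rewrite m_itv// (G0 n0) subr0.
Unshelve. all: by end_near. Qed.

Let m_fin : fin_num_fun m.
Proof.
move=> A mA; rewrite ge0_fin_numE//.
suff mT : (m setT <= C%:E)%E.
  rewrite (le_lt_trans (le_measure m _ _ (@subsetT _ A))) ?inE//.
  by rewrite (le_lt_trans mT) ?ltry.
rewrite -(bigcup_itvT false false).
have : m `]-n%:R, n%:R] @[n --> \oo] --> m (\bigcup_n `]-n%:R, n%:R]%classic).
  apply: nondecreasing_cvg_mu => //; first exact: bigcup_measurable.
  by move=> *; apply/subsetPset/subset_itv; rewrite leBSide/= ?lerN2 ler_nat.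
move=> mcvg; rewrite -(cvg_lim _ mcvg)//.
apply: lime_le; first by apply/cvg_ex; eexists; exact: mcvg.
apply: nearW => n; rewrite m_itv ?ge0_cp// lee_fin.
by have /andP[_ ?] := GC n%:R; have /andP[? _] := GC (- n%:R); lra.
Qed.

(** The Stieltjes measure of [G] lives on the whole line and gives no mass to
    the negative half-line; it is transported by the retraction [clampR]. *)
Lemma stieltjes_Rplus : exists mu : {finite_measure set (Rplus R) -> \bar R},
  forall s, mu (below s) = (G s)%:E.
Proof.
pose F := @Measure_isFinite.Build _ _ _ (lebesgue_stieltjes_measure G) m_fin.
pose mf : {finite_measure set (measurableTypeR R) -> \bar R} :=
  HB.pack (lebesgue_stieltjes_measure G) F.
have [mu muE] := pushforward_finite mf (@measurable_clampR R).
exists mu => s; rewrite muE /pushforward.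
have [s0|s0] := leP 0 s.
  rewrite -m_ray; congr m; apply/seteqP; split => u; rewrite /= in_itv/=.
    by rewrite /below/= ge_max => /andP[].
  by rewrite /below/= ge_max s0.
rewrite G0// (_ : _ @^-1` _ = set0) ?measure0// -subset0 => u.
by rewrite /below/= ge_max leNgt s0.
Qed.

End cumulative.

(** * Integrals of ramps against a finite measure *)

Section integral_functional.
Context {R : realType} (mu : {finite_measure set (Rplus R) -> \bar R}).
Implicit Types f g : Rplus R -> R.

Lemma vanishing_integrable f : vanishing f -> mu.-integrable setT (EFin \o f).
Proof.
move=> vf; apply: measurable_bounded_integrable => //.
- by rewrite -ge0_fin_numE// fin_num_measure.
- exact: continuous_Rplus_measurable vf.1.
have [c fc] := vanishing_bounded vf.
exists c; split; first exact: num_real.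
by move=> x cx t _; exact: le_trans (fc t) (ltW cx).
Qed.

Lemma integral_positive_additive :
  positive_additive (fun f => \int[mu]_t f t).
Proof.
split=> [f vf f0|f g vf vg f0 g0]; first exact: Rintegral_ge0.
by rewrite RintegralD//; exact: vanishing_integrable.
Qed.

Lemma integral_bounded_linear :
  bounded_linear (fine (mu setT)) (fun f => \int[mu]_t f t).
Proof.
split=> [a f g vf vg|f c vf fc].
  rewrite RintegralD//.
  - by rewrite RintegralZl//; exact: vanishing_integrable.
  - exact: (vanishing_integrable (vanishingZ a vf)).
  - exact: vanishing_integrable.
rewrite mulrC -Rintegral_cst//.
apply: (le_trans (le_normr_Rintegral _ (vanishing_integrable vf))) => //.
apply: le_Rintegral => //.
- exact/integrable_norm/vanishing_integrable.
- exact: finite_measure_integrable_cst.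
Qed.

(** A ramp lies between the indicators of two initial segments. *)
Lemma integral_ramp_below s d : 0 < d ->
  fine (mu (below s)) <= \int[mu]_t ramp s d t <= fine (mu (below (s + d))).
Proof.
move=> d0; have indE u : fine (mu (below u)) = \int[mu]_t \1_(below u) t.
  by rewrite /Rintegral integral_indic ?setIT//; exact: measurable_below.
have iind u : mu.-integrable setT (EFin \o (\1_(below u) : Rplus R -> R)).
  by apply: integrable_indic; exact: measurable_below.
have iramp := vanishing_integrable (vanishing_ramp s d0).
have indicE (u : R) (t : Rplus R) : \1_(below u) t = (set_val t <= u)%R%:R :> R.
  rewrite numfun.indicE; congr ((nat_of_bool _)%:R).
  by apply/idP/idP; rewrite inE.
rewrite !indE; apply/andP; split; apply: le_Rintegral => // t _; rewrite indicE.
  have [ts|_] := leP (set_val t) s; first by rewrite ramp1.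
  by case/andP: (ramp_itv s d t).
have [_|/ltW ts] := leP (set_val t) (s + d); last by rewrite ramp0.
by case/andP: (ramp_itv s d t).
Qed.

Lemma integral_ramp_sandwich G : (forall s, mu (below s) = (G s)%:E) ->
  sandwich (fun f => \int[mu]_t f t) G.
Proof.
move=> muG s d d0.
have /andP[H1 H2] := integral_ramp_below s d0.
have GE u : G u = fine (mu (below u)) by rewrite muG.
rewrite !GE.
rewrite H2 andbT (le_trans _ H1)// fine_le ?fin_num_measure//;
  try exact: measurable_below.
apply: le_measure; rewrite ?inE; try exact: measurable_below.
by move=> t /= /le_trans; apply; lra.
Qed.

End integral_functional.

Section uniqueness.
Context {R : realType}.

Lemma below_right_continuous
    (m : {finite_measure set (Rplus R) -> \bar R}) (s : R) :
  m (below (s + n.+1%:R^-1)) @[n --> \oo] --> m (below s).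
Proof.
have -> : below s = \bigcap_n below (s + n.+1%:R^-1).
  apply/seteqP; split => [t ts n _|t H].
    by rewrite /below/= (le_trans ts)// lerDl.
  rewrite /below/=; apply/ler_addgt0Pr => e e0.
  have [n ne] := ltr_add_invr e0.
  apply: (le_trans (H n I)); rewrite lerD2l; apply: ltW.
  by rewrite add0r in ne.
apply: nonincreasing_cvg_mu => //.
- by rewrite -ge0_fin_numE// fin_num_measure//; exact: measurable_below.
- by move=> n; exact: measurable_below.
- by apply: bigcap_measurable => // n _; exact: measurable_below.
- move=> a b ab; apply/subsetPset => t /= /le_trans; apply.
  by rewrite lerD2l lef_pV2 ?posrE// ler_nat.
Qed.

Let le_below (m1 m2 : {finite_measure set (Rplus R) -> \bar R}) s :
  (forall s d : R, 0 < d ->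
    \int[m1]_t ramp s d t = \int[m2]_t ramp s d t) ->
  (m1 (below s) <= m2 (below s))%E.
Proof.
move=> m12.
rewrite -(cvg_lim _ (below_right_continuous (m := m2) (s := s)))//.
apply: lime_ge.
  by apply/cvg_ex; exists (m2 (below s)); exact: below_right_continuous.
apply: nearW => n; have n0 : 0 < n.+1%:R^-1 :> R by rewrite invr_gt0.
have /andP[H1 _] := integral_ramp_below m1 s n0.
have /andP[_ H2] := integral_ramp_below m2 s n0.
rewrite -(fineK (fin_num_measure m1 _ (measurable_below s))).
rewrite -(fineK (fin_num_measure m2 _ (measurable_below (s + n.+1%:R^-1)))).
by rewrite lee_fin (le_trans H1)// m12.
Qed.

(** Integrals of ramps of width tending to 0 determine the masses of the initial
    segments, and these determine the images of the two measures on the line,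
    where half-open intervals generate the Borel sets. *)
Lemma ramp_measure_unique (m1 m2 : {finite_measure set (Rplus R) -> \bar R}) :
  (forall s d : R, 0 < d -> \int[m1]_t ramp s d t = \int[m2]_t ramp s d t) ->
  forall A, measurable A -> m1 A = m2 A.
Proof.
move=> m12.
have below12 s : m1 (below s) = m2 (below s).
  by apply/eqP; rewrite eq_le !le_below// => u d d0; rewrite m12.
have mval : measurable_fun setT (set_val : Rplus R -> measurableTypeR R).
  exact: measurable_set_val.
have [p1 p1E] := pushforward_finite m1 mval.
have [p2 p2E] := pushforward_finite m2 mval.
have p12_itv (a b : R) : p1 `]a, b]%classic = p2 `]a, b]%classic.
  rewrite p1E p2E /pushforward/=.
  rewrite (_ : _ @^-1` _ = below b `\` below a); last first.
    apply/seteqP; split => t; rewrite /= in_itv/=.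
      by move=> /andP[bt tb]; split => //; apply/negP; rewrite -ltNge.
    by move=> [tb /negP]; rewrite -ltNge /below/= => ->.
  have fin (m : {finite_measure set (Rplus R) -> \bar R}) :
      (m (below b) < +oo)%E.
    by rewrite -ge0_fin_numE// fin_num_measure//; exact: measurable_below.
  rewrite !measureD ?fin//; try exact: measurable_below.
  have belowI : below b `&` below a = below (Num.min b a) :> set (Rplus R).
    apply/seteqP; split => t /=; rewrite /below/= le_min.
      by move=> [-> ->].
    by move=> /andP[].
  by rewrite belowI; congr (_ - _)%E; exact: below12.
have p1fin n : (p1 `](- n%:R)%R, n%:R%R]%classic < +oo)%E.
  by rewrite -ge0_fin_numE// fin_num_measure//; exact: measurable_itv.
have p12 (A : set (measurableTypeR R)) : measurable A -> p1 A = p2 A.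
  apply: (@measure_unique _ R (measurableTypeR R) (@ocitv R)
    (fun n => `]- n%:R, n%:R]%classic) erefl (@ocitvI R) (fun n => is_ocitv _ _)
    (bigcup_itvT false false) p1 p2) => [_ [[a b] _ <-]|n].
    exact: p12_itv.
  exact: p1fin.
move=> A mA.
have := p12 (@clampR R @^-1` A).
rewrite p1E p2E /pushforward.
rewrite (_ : set_val @^-1` _ = A); last first.
  by apply/seteqP; split => t /=; rewrite clampRK.
apply; rewrite -[X in measurable X]setTI.
by apply: measurable_clampR.
Qed.

End uniqueness.

(** * Density of the combinations of ramps *)

Section density.
Context {R : realType}.
Implicit Types (f : Rplus R -> R) (L : (Rplus R -> R) -> R).

(** The Heine-Cantor theorem, in a form where only one of the two points has to
    lie in the segment: grid points are in the segment, while the point of the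
    last cell may exceed [M]. *)
Lemma uniformly_continuous_segment (h : R -> R) (M e : R) :
  continuous h -> 0 < e -> exists2 d, 0 < d &
    forall x y, 0 <= x <= M -> `|y - x| < d -> `|h y - h x| < e.
Proof.
move=> ch e0.
have /compact_near_coveringP/(_ _ (at_right (0 : R))
   (fun d x => forall y, `|y - x| < d -> `|h y - h x| < e)) :=
   @segment_compact R 0 M.
case=> [x _|d /= d0 H].
  have e20 : 0 < e / 2 by rewrite divr_gt0.
  have /cvgrPdist_lt/(_ _ e20)[r /= r0 hr] := ch x.
  have r20 : 0 < r / 2 by rewrite divr_gt0.
  exists (ball x (r / 2), [set d | 0 < d < r / 2]).
    split => /=; first exact: nbhsx_ballx.
    exists (r / 2) => //= d; rewrite /ball_/= sub0r normrN => dr d0.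
    by rewrite d0/= (le_lt_trans _ dr)// ler_norm.
  move=> [z d] [/= xz /andP[_ dr]] y yz.
  (* Both [y] and [z] are within [r] of [x]. *)
  have H1 : `|h x - h z| < e / 2.
    by apply: hr; rewrite /ball/= (lt_trans xz)//; lra.
  have H2 : `|h x - h y| < e / 2.
    apply: hr; rewrite /ball/= -(subrK z x) -addrA.
    rewrite (le_lt_trans (ler_normD _ _))//.
    rewrite distrC in yz; have : `|x - z| < r / 2 by [].
    by lra.
  rewrite -(subrK (h x) (h y)) -addrA (le_lt_trans (ler_normD _ _))//.
  by rewrite distrC; lra.
exists (d / 2); first by rewrite divr_gt0.
move=> x y xM; apply: (H (d / 2)) => /=.
- by rewrite sub0r normrN gtr0_norm ?divr_gt0//; lra.
- by rewrite divr_gt0.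
- by rewrite in_itv.
Qed.

(** The function that interpolates [f - f (d * m)] linearly at the points
    [d * j], [j <= m], and vanishes afterwards. *)
Definition ramp_interpolation f (d : R) m : Rplus R -> R :=
  fun t => \sum_(j < m) (f (clampR (d * j%:R)) - f (clampR (d * j.+1%:R))) *
                      ramp (d * j%:R) d t.

(** On the [k]-th cell of the grid the ramps of smaller index have vanished, and
    those of larger index are equal to 1 and telescope. *)
Lemma ramp_interpolationE f (d : R) m k t : 0 < d -> (k < m)%N ->
  d * k%:R <= set_val t <= d * k.+1%:R ->
  ramp_interpolation f d m t =
  (f (clampR (d * k%:R)) - f (clampR (d * k.+1%:R))) * ramp (d * k%:R) d t
  + (f (clampR (d * k.+1%:R)) - f (clampR (d * m%:R))).
Proof.
move=> d0 km /andP[kt tk]; rewrite /ramp_interpolation.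
pose h j := f (clampR (d * j%:R)).
rewrite -(big_mkord xpredT (fun j => (h j - h j.+1) * ramp (d * j%:R) d t)).
rewrite (@big_cat_nat _ _ _ k) ?(ltnW km)//= big_nat big1 ?add0r; last first.
  move=> j /andP[_ jk]; rewrite ramp0 ?mulr0//.
  rewrite -[X in _ + X]mulr1 -mulrDr natr1 (le_trans _ kt)//.
  by rewrite ler_pM2l// ler_nat.
rewrite big_ltn//; congr (_ + _); rewrite -/(h k.+1) -/(h m).
rewrite -[RHS]opprB -(telescope_sumr h km) -sumrN.
apply: eq_big_nat => j /andP[kj _].
rewrite ramp1// ?mulr1 ?opprB//.
by rewrite (le_trans tk)// ler_pM2l// ler_nat.
Qed.

Lemma ramp_interpolation0 f (d : R) m t : 0 < d -> d * m%:R <= set_val t ->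
  ramp_interpolation f d m t = 0.
Proof.
move=> d0 mt; rewrite /ramp_interpolation big1// => j _; rewrite ramp0 ?mulr0//.
rewrite -[X in _ + X]mulr1 -mulrDr natr1 (le_trans _ mt)// ler_pM2l// ler_nat.
exact: ltn_ord.
Qed.

(** On a cell the interpolation differs from [f] by two oscillations of [f] over
    the grid step and by the value of [f] at the last grid point, which lies
    beyond [M], where [f] is small. *)
Lemma ramp_approximation f (e : R) : vanishing f -> 0 < e ->
  exists2 d, 0 < d &
  exists m, forall t, `|f t - ramp_interpolation f d m t| <= e.
Proof.
move=> vf e0; have e30 : 0 < e / 3 by rewrite divr_gt0.
have [M M0 fM] := vanishing_small vf e30.
have cf : continuous (f \o @clampR R).
  by move=> s; apply: continuous_comp; [exact: clampR_continuous|exact: vf.1].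
have [d d0 fd] := uniformly_continuous_segment M cf e30.
pose c := d / 2; have c0 : 0 < c by rewrite divr_gt0.
have cd : c < d by rewrite /c; lra.
pose m := (Num.truncn (M / c)).+1.
have Mm : M < c * m%:R.
  by rewrite mulrC -ltr_pdivrMr//; exact: truncnS_gt.
exists c => //; exists m => t.
have t0 : 0 <= set_val t := set_valP t.
have [mt|tm] := leP (c * m%:R) (set_val t).
  rewrite ramp_interpolation0// subr0 (le_trans (ltW (fM t _)))//; last lra.
  exact: lt_le_trans mt.
pose k := Num.truncn (set_val t / c).
have /andP[kt tk] : k%:R <= set_val t / c < k.+1%:R.
  by apply: truncn_itv; rewrite divr_ge0// ltW.
rewrite ler_pdivlMr// mulrC in kt; rewrite ltr_pdivrMr// mulrC in tk.
have km : (k < m)%N.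
  by rewrite -(ltr_nat R) -(ltr_pM2l c0) (le_lt_trans kt).
rewrite (ramp_interpolationE _ c0 km) ?kt ?(ltW tk)//.
set hk := f (clampR (c * k%:R)); set hk1 := f (clampR (c * k.+1%:R)).
set hm := f (clampR (c * m%:R)).
have kM : 0 <= c * k%:R <= M.
  rewrite mulr_ge0 ?(ltW c0)//= mulrC -ler_pdivlMr//.
  by rewrite -truncn_ge_nat; [exact: km|rewrite divr_ge0 ?(ltW c0)].
have H1 : `|hk1 - hk| < e / 3.
  apply: (fd _ _ kM); rewrite -natr1 mulrDr mulr1 addrC addKr.
  by rewrite gtr0_norm.
have H2 : `|f t - hk| < e / 3.
  have := fd _ (set_val t) kM; rewrite /= clampRK; apply.
  rewrite ger0_norm ?subr_ge0// (lt_trans _ cd)// ltrBlDl.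
  by rewrite -[X in _ + X]mulr1 -mulrDr natr1.
have H3 : `|hm| < e / 3.
  apply: fM; rewrite (lt_le_trans Mm)//.
  by rewrite /set_val/= /clampR/= le_max lexx orbT.
have /andP[r0 r1] := ramp_itv (c * k%:R) c t.
move: (ramp _ _ _) r0 r1 => r r0 r1.
rewrite (_ : _ - _ = (f t - hk) + (1 - r) * (hk - hk1) + hm); last by ring.
have H4 : `|(1 - r) * (hk - hk1)| <= e / 3.
  rewrite normrM (@ger0_norm _ (1 - r)) ?subr_ge0// distrC.
  by apply: (le_trans _ (ltW H1)); rewrite ler_piMl//; lra.
apply: (le_trans (ler_normD _ _)).
have := ler_normD (f t - hk) ((1 - r) * (hk - hk1)).
lra.
Qed.

Lemma bounded_linear0 C L : bounded_linear C L -> L (fun=> 0) = 0.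
Proof.
move=> bL; have := bbound bL vanishing0 (c := 0).
rewrite mulr0 normr0 => /(_ (fun=> lexx 0)) L0.
by apply/eqP; rewrite -normr_le0.
Qed.

Lemma vanishing_interpolation f (d : R) m : 0 < d ->
  vanishing (ramp_interpolation f d m).
Proof.
move=> d0; apply: (@vanishing_sum _ (fun j t =>
  (f (clampR (d * j%:R)) - f (clampR (d * j.+1%:R))) * ramp (d * j%:R) d t)).
by move=> k; apply: vanishingZ; exact: vanishing_ramp.
Qed.

(** The two functionals agree on interpolations, which approximate [f]
    uniformly. *)
Lemma eq_bounded_linear C1 C2 L1 L2 :
  bounded_linear C1 L1 -> bounded_linear C2 L2 ->
  (forall s d : R, 0 < d -> L1 (ramp s d) = L2 (ramp s d)) ->
  forall f, vanishing f -> L1 f = L2 f.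
Proof.
move=> b1 b2 r12 f vf.
have C_ge0 C L : bounded_linear C L -> 0 <= C.
  move=> bL; rewrite -[C]mulr1 (le_trans (normr_ge0 (L (fun=> 0))))//.
  by apply: (bbound bL) => [|t]; [exact: vanishing0|rewrite normr0].
have C10 := C_ge0 _ _ b1; have C20 := C_ge0 _ _ b2.
have int12 d m : 0 < d ->
    L1 (ramp_interpolation f d m) = L2 (ramp_interpolation f d m).
  move=> d0; elim: m => [|m IHm].
    rewrite (_ : ramp_interpolation _ _ _ = fun=> 0).
      by rewrite (bounded_linear0 b1) (bounded_linear0 b2).
    by apply/funext => t; rewrite /ramp_interpolation big_ord0.
  have vm := vanishing_interpolation f m d0.
  have vr := vanishing_ramp (d * m%:R) d0.
  rewrite (_ : ramp_interpolation _ _ _ = fun t =>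
      (f (clampR (d * m%:R)) - f (clampR (d * m.+1%:R))) *
      ramp (d * m%:R) d t + ramp_interpolation f d m t); last first.
    by apply/funext => t; rewrite /ramp_interpolation big_ord_recr/= addrC.
  by rewrite (blin b1 _ vr vm) (blin b2 _ vr vm) IHm r12.
have LB C L g : bounded_linear C L -> vanishing g ->
    L (fun t => f t - g t) = L f - L g.
  move=> bL vg; rewrite [in RHS](_ : f = fun t => 1 * (f t - g t) + g t).
    by rewrite (blin bL)// ?mul1r ?addrK//; exact: vanishingB.
  by apply/funext => t; rewrite mul1r subrK.
apply/eqP; rewrite -subr_eq0 -normr_le0; apply/ler_addgt0Pr => e e0.
(* The summand 1 keeps the denominator positive. *)
rewrite add0r; have C0 : 0 < C1 + C2 + 1 by lra.
have ec0 : 0 < e / (C1 + C2 + 1) by rewrite divr_gt0.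
have [d d0 [m fm]] := ramp_approximation vf ec0.
have vm := vanishing_interpolation f m d0.
have vfm := vanishingB vf vm.
have := bbound b1 vfm fm; have := bbound b2 vfm fm.
rewrite (LB _ _ _ b1)// (LB _ _ _ b2)// int12//.
set x := L2 (ramp_interpolation _ _ _) => H2 H1.
rewrite (_ : L1 f - L2 f = (L1 f - x) - (L2 f - x)); last by ring.
apply: (le_trans (ler_normB _ _)); apply: (le_trans (lerD H1 H2)).
rewrite -mulrDl mulrCA ler_piMr ?(ltW e0)// ler_pdivrMr//; lra.
Qed.

End density.

(** * Riesz representation for vanishing functions *)

Section riesz.
Context {R : realType}.

(** Ramps suffice here: the extension to all vanishing functions needs
    linearity, which is available for the difference of two positive
    functionals and not on the cone. *)
Lemma riesz_positive (Q : (Rplus R -> R) -> R) (C : R) :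
  positive_additive Q ->
  (forall f c, vanishing f -> nneg f -> (forall t, f t <= c) -> Q f <= C * c) ->
  exists mu : {finite_measure set (Rplus R) -> \bar R},
    forall s d : R, 0 < d -> Q (ramp s d) = \int[mu]_t ramp s d t.
Proof.
move=> pQ QC.
have [mu muG] := stieltjes_Rplus (ramp_inf_nondecreasing pQ)
  (ramp_inf_right_continuous pQ) (ramp_inf_itv pQ QC) (ramp_inf_lt0 pQ QC).
exists mu => s d d0.
exact: (sandwich_unique s pQ (integral_positive_additive mu)
  (ramp_inf_sandwich pQ) (integral_ramp_sandwich muG) (ramp_inf_itv pQ QC) d0).
Qed.

Lemma riesz_vanishing (L : (Rplus R -> R) -> R) (C : R) :
  bounded_linear C L ->
  exists mu1 mu2 : {finite_measure set (Rplus R) -> \bar R},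
    forall f, vanishing f -> L f = \int[mu1]_t f t - \int[mu2]_t f t.
Proof.
move=> bL.
have [mu1 mu1E] := riesz_positive (positive_part_additive bL)
  (positive_part_le bL).
have [mu2 mu2E] := riesz_positive (negative_part_additive bL)
  (negative_part_le bL).
exists mu1, mu2.
apply: (eq_bounded_linear bL (C2 := fine (mu1 setT) + fine (mu2 setT))).
  have b1 := integral_bounded_linear mu1.
  have b2 := integral_bounded_linear mu2.
  split=> [a f g vf vg|f c vf fc].
    by rewrite (blin b1)// (blin b2)//; ring.
  rewrite (le_trans (ler_normB _ _))// mulrDl.
  by rewrite lerD// ?(bbound b1)// (bbound b2).
by move=> s d d0; rewrite -mu1E// -mu2E//; ring.
Qed.

End riesz.

(** * Regularity of finite measures on the half-line *)

Lemma Rplus_hausdorff (R : realType) : hausdorff_space (Rplus R).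
Proof.
have cval (t : Rplus R) : set_val @ t --> set_val t.
  exact: initial_continuous.
move=> p q pq; apply: val_inj; apply: Rhausdorff => A B pA qB.
have [t [At Bt]] := pq _ _ (cval p _ pA) (cval q _ qB).
by exists (set_val t).
Qed.

Section regularity.
Context {R : realType}.
Variable m : {measure set (Rplus R) -> \bar R}.
Hypothesis mfin : fin_num_fun m.

Let m_lty A : measurable A -> (m A < +oo)%E.
Proof. by move=> mA; rewrite -ge0_fin_numE// mfin. Qed.

(** Closed sets are used from inside, rather than compact ones, to make the
    condition symmetric under complements. *)
Definition approximable (A : set (Rplus R)) := forall e : R, 0 < e ->
  exists C U, [/\ closed C, open U, C `<=` A, A `<=` U &
    (m (U `\` C) < e%:E)%E].

(** Continuity from above, in the form used to truncate a countable union or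
    intersection at a finite stage. *)
Lemma measure_cvg_small (F : (set (Rplus R))^nat) (e : R) :
  (forall n, measurable (F n)) -> nonincreasing_seq F -> 0 < e ->
  (m (\bigcap_n F n) < e%:E)%E -> exists n, (m (F n) < e%:E)%E.
Proof.
move=> mF niF e0 Fe.
have mFI : measurable (\bigcap_n F n).
  by apply: bigcap_measurable => // n _; exact: mF.
have cF := nonincreasing_cvg_mu (m_lty (mF 0%N)) mF mFI niF.
have [n _ H] := cF _ (open_ereal_lt' Fe).
by exists n; exact: H (leqnn n).
Qed.

(** An open set is the increasing union of the closed sets of points at distance
    at least [1 / n.+1] from its complement. *)
Lemma open_approximable (U : set (Rplus R)) : open U -> approximable U.
Proof.
move=> oU e e0.
pose C n := \bigcap_(y in ~` U)
  [set t : Rplus R | n.+1%:R^-1 <= `|set_val t - set_val y|].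
have cC n : closed (C n).
  apply: closed_bigI => y _.
  apply: (@preimage_closed _ R (fun t : Rplus R => `|set_val t - set_val y|)
    [set u : R | n.+1%:R^-1 <= u]); last exact: closed_ge.
  move=> t _.
  apply: (@continuous_comp _ R R (fun t : Rplus R => set_val t - set_val y)
    (fun u : R => `|u|)).
    have ct : set_val @ t --> set_val t by exact: initial_continuous.
    exact: (cvgB ct (cvg_cst (set_val y))).
  exact: norm_continuous.
have CU n : C n `<=` U.
  move=> t Ct; apply: contrapT => Ut.
  by have := Ct t Ut; rewrite /= subrr normr0 leNgt invr_gt0 ltr0n.
have UC : \bigcap_n (U `\` C n) = set0.
  rewrite -subset0 => t /= H; have [Ut _] := H 0%N I.
  have [V oV UV] := oU; have Vt : V (set_val t) by move: Ut; rewrite -UV.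
  have /nbhs_ballP[r /= r0 rV] := open_nbhs_nbhs (conj oV Vt).
  have [n nr] := ltr_add_invr r0; rewrite add0r in nr.
  have [_] := H n I; apply => y Uy /=; rewrite leNgt; apply/negP => yr.
  apply: Uy; rewrite -UV; suff /rV : ball (set_val t) r (set_val y) by [].
  exact: lt_trans yr nr.
have [n Hn] : exists n, (m (U `\` C n) < e%:E)%E.
  apply: measure_cvg_small => //; last by rewrite UC measure0 lte_fin.
    move=> n; apply: measurableD; first exact: open_Rplus_measurable.
    exact: closed_Rplus_measurable.
  move=> a b ab; apply/subsetPset; apply: setDS => t Ct y Uy /=.
  by rewrite (le_trans _ (Ct y Uy))// lef_pV2 ?posrE// ler_nat.
by exists (C n), U; split.
Qed.

Lemma approximable_setC A : approximable A -> approximable (~` A).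
Proof.
move=> aA e e0; have [C [U [cC oU CA AU mUC]]] := aA e e0.
exists (~` U), (~` C); split.
- exact: open_closedC.
- exact: closed_openC.
- exact: subsetC.
- exact: subsetC.
- by rewrite (_ : _ `\` _ = U `\` C)// setDE setCK setIC.
Qed.

(** The errors for the sets [A n] are chosen to add up to [e / 2].  This leaves
    room to replace the union of the inner closed sets, which need not be
    closed, by a finite union. *)
Lemma approximable_bigcup (A : (set (Rplus R))^nat) :
  (forall n, approximable (A n)) -> approximable (\bigcup_n A n).
Proof.
move=> aA e e0; have e2 n : 0 < e / 2 / (2 ^ n.+1)%:R :> R.
  by rewrite !divr_gt0// ltr0n expn_gt0.
have /choice[F HF] n := aA n _ (e2 n).
have /choice[V HV] := HF.
pose C n := F n; pose U := \bigcup_n V n.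
have cC n : closed (C n) by have [] := HV n.
have oV n : open (V n) by have [] := HV n.
have mC n := closed_Rplus_measurable (cC n).
have mV n := open_Rplus_measurable (oV n).
have oU : open U by exact: bigcup_open.
have mU := open_Rplus_measurable oU.
have mCN n : measurable (\big[setU/set0]_(i < n) C i).
  by apply: bigsetU_measurable => i _.
have [n Hn] : exists n, (m (U `\` \big[setU/set0]_(i < n) C i) < e%:E)%E.
  apply: measure_cvg_small => //.
  - by move=> n; exact: measurableD.
  - move=> a b ab; apply/subsetPset; apply: setDS.
    exact: subset_bigsetU.
  - apply: (@le_lt_trans _ _ (\sum_(i <oo) (m (V i `\` C i)))%E).
      apply: measure_sigma_subadditive.
      + by move=> n; exact: measurableD.
      + by apply: bigcap_measurable => // n _; exact: measurableD.
      + move=> t Ht; have [[n _ Vt] _] := Ht 0%N I.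
        exists n => //; split => // Ct.
        have [_] := Ht n.+1 I; apply.
        by rewrite -bigcup_mkord; exists n => //=.
    apply: (@le_lt_trans _ _ (\sum_(i <oo) (e / 2 / (2 ^ i.+1)%:R)%:E)%E).
      apply: lee_nneseries => [i _ _|i _]; first exact: measure_ge0.
      by have [_ _ _ _ H] := HV i; exact: (ltW H).
    apply: (le_lt_trans (epsilon_trick0 _ _)); first by rewrite divr_ge0// ltW.
    by rewrite lte_fin; lra.
exists (\big[setU/set0]_(i < n) C i), U; split => //.
- by apply: closed_bigsetU => i _.
- rewrite -bigcup_mkord => t [i _ Ct]; exists i => //.
  by have [_ _ CA _ _] := HV i; exact: CA.
- move=> t [i _ At]; exists i => //.
  by have [_ _ _ AV _] := HV i; exact: AV.
Qed.

Lemma measurable_approximable A : measurable A -> approximable A.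
Proof.
apply: smallest_sub; last exact: open_approximable.
split.
- by apply: open_approximable; exact: open0.
- by move=> B aB; rewrite setTD; exact: approximable_setC.
- by move=> F; exact: approximable_bigcup.
Qed.

Lemma compact_below (s : R) : compact (below s).
Proof.
rewrite (_ : below s = @clampR R @` `[0, s]).
  apply: continuous_compact; last exact: segment_compact.
  by apply: continuous_subspaceT => u; exact: clampR_continuous.
apply/seteqP; split => [t ts|_ [u /= + <-]].
  exists (set_val t); last exact: clampRK.
  by rewrite /= in_itv/= ts andbT; exact: (set_valP t).
by rewrite in_itv/= /below/= => /andP[u0 us]; rewrite ge_max us (le_trans u0).
Qed.

Lemma compact_inner (C : set (Rplus R)) (e : R) : closed C -> 0 < e ->
  exists K, [/\ compact K, K `<=` C & (m (C `\` K) < e%:E)%E].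
Proof.
move=> cC e0; have mC := closed_Rplus_measurable cC.
have [n Hn] : exists n, (m (C `\` below n%:R) < e%:E)%E.
  apply: measure_cvg_small => //.
  - by move=> n; apply: measurableD => //; exact: measurable_below.
  - move=> a b ab; apply/subsetPset; apply: setDS => t /= /le_trans; apply.
    by rewrite ler_nat.
  - rewrite (_ : \bigcap_n _ = set0) ?measure0 ?lte_fin// -subset0 => t Ht.
    have [_] := Ht (Num.bound (set_val t)) I; apply; rewrite /below/= ltW//.
    by apply: archi_boundP; exact: (set_valP t).
exists (below n%:R `&` C); split.
- by apply: compact_closedI => //; exact: compact_below.
- exact: subIsetr.
- by rewrite setIC setDIr setDv set0U.
Qed.

Lemma finite_measure_regular A : measurable A ->
  m A = ereal_sup [set m K | K in [set K | compact K /\ K `<=` A]] /\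
  m A = ereal_inf [set m U | U in [set U | open U /\ A `<=` U]].
Proof.
move=> mA; have aA := measurable_approximable mA.
split; apply/eqP; rewrite eq_le; apply/andP; split.
- apply/lee_addgt0Pr => e e0.
  have e20 : 0 < e / 2 by rewrite divr_gt0.
  have [C [U [cC oU CA AU mUC]]] := aA _ e20.
  have [K [cK KC mCK]] := compact_inner cC e20.
  have mC := closed_Rplus_measurable cC.
  have mU := open_Rplus_measurable oU.
  have mK : measurable K.
    apply: closed_Rplus_measurable; apply: compact_closed => //.
    exact: Rplus_hausdorff.
  have mC_K : measurable (C `\` K) by exact: measurableD.
  have mUC' : measurable (U `\` C) by exact: measurableD.
  have mCKUC : measurable ((C `\` K) `|` (U `\` C)) by exact: measurableU.
  apply: (@le_trans _ _ (m (K `|` ((C `\` K) `|` (U `\` C))))).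
    apply: le_measure; rewrite ?inE//; first exact: measurableU.
    move=> t /AU Ut; have [Ct|Ct] := pselect (C t); last by right; right.
    by have [Kt|Kt] := pselect (K t); [left|right; left].
  apply: (le_trans (measureU2 _ _ _)) => //; apply: leeD.
    by apply: ereal_sup_ubound; exists K => //; split => // t /KC /CA.
  apply: (le_trans (measureU2 _ _ _)) => //.
  by rewrite (splitr e) EFinD leeD// ltW.
- apply: ge_ereal_sup => _ [K [cK KA] <-]; apply: le_measure; rewrite ?inE//.
  apply: closed_Rplus_measurable; apply: compact_closed => //.
  exact: Rplus_hausdorff.
- apply: le_ereal_inf_tmp => _ [U [oU AU] <-].
  apply: le_measure; rewrite ?inE//.
  exact: open_Rplus_measurable.
- apply/lee_addgt0Pr => e e0.
  have [C [U [cC oU CA AU mUC]]] := aA _ e0.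
  have mC := closed_Rplus_measurable cC.
  have mU := open_Rplus_measurable oU.
  have mUC' : measurable (U `\` C) by exact: measurableD.
  apply: (@le_trans _ _ (m U)).
    by apply: ereal_inf_lbound; exists U.
  apply: (@le_trans _ _ (m (A `|` (U `\` C)))).
    apply: le_measure; rewrite ?inE//; first exact: measurableU.
    move=> t Ut; have [Ct|Ct] := pselect (C t); last by right.
    by left; exact: CA.
  by apply: (le_trans (measureU2 _ _ _)) => //; rewrite leeD2l// ltW.
Qed.

End regularity.

(** * Integrals against charges *)

Section charges.
Context {R : realType}.
Implicit Types (m p : {finite_measure set (Rplus R) -> \bar R})
  (nu : {charge set (Rplus R) -> \bar R}) (f : Rplus R -> R).

Lemma finite_measure_add m1 m2 :
  exists m, (forall A, m A = (m1 A + m2 A)%E) /\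
    forall f, vanishing f -> \int[m]_t f t = \int[m1]_t f t + \int[m2]_t f t.
Proof.
have mfin : fin_num_fun (measure_add m1 m2).
  by move=> A mA; rewrite measure_addE fin_numD !fin_num_measure.
pose m0 : {measure set (Rplus R) -> \bar R} := measure_add m1 m2.
pose F := @Measure_isFinite.Build _ _ _ m0 mfin.
pose m : {finite_measure set (Rplus R) -> \bar R} :=
  HB.pack (Measure.sort m0) m0 F.
exists m; split=> [A|f vf]; first exact: measure_addE.
rewrite /Rintegral.
rewrite (_ : integral m _ _ = integral (measure_add m1 m2) setT (EFin \o f))//.
have i1 := vanishing_integrable m1 vf.
have i2 := vanishing_integrable m2 vf.
rewrite integral_measure_add//.
by rewrite fineD//; exact: integrable_fin_num.
Qed.

Lemma Rintegral_eq_measure m1 m2 f : (forall A, measurable A -> m1 A = m2 A) ->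
  \int[m1]_t f t = \int[m2]_t f t.
Proof.
move=> m12; rewrite /Rintegral (eq_measure_integral m2)// => A mA _.
exact: m12.
Qed.

Lemma jordan_difference nu A : measurable A ->
  (nu A + jordan_neg (hahnP nu) A = jordan_pos (hahnP nu) A)%E.
Proof.
move=> mA; rewrite (jordan_decomp (hahnP nu) mA) /cadd/= cscaleN1.
by rewrite subeK// fin_num_measure.
Qed.

(** The integral against a charge can be computed with any decomposition as a
    difference of finite measures: [p1 - p2] and the Jordan decomposition become
    comparable after moving the subtracted terms to the other side. *)
Lemma charge_integralE nu p1 p2 f :
  (forall A, measurable A -> nu A = (p1 A - p2 A)%E) -> vanishing f ->
  charge_integral nu f = \int[p1]_t f t - \int[p2]_t f t.
Proof.
move=> nuE vf.
have [m1 [m1E m1f]] := finite_measure_add (jordan_pos (hahnP nu)) p2.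
have [m2 [m2E m2f]] := finite_measure_add p1 (jordan_neg (hahnP nu)).
have : \int[m1]_t f t = \int[m2]_t f t.
  apply: Rintegral_eq_measure => A mA.
  rewrite m1E m2E /= -jordan_difference// nuE//.
  by rewrite addeAC subeK// fin_num_measure.
rewrite m1f// m2f// /charge_integral.
set a := (X in X + _ = _); set b := (X in _ = _ + X) => ab.
by apply/eqP; rewrite subr_eq addrAC -subr_eq opprK ab.
Qed.

(** The same exchange of the negative parts turns an equality of two charges
    into an equality of two measures. *)
Lemma charge_unique nu1 nu2 :
  (forall s d : R, 0 < d ->
    charge_integral nu1 (ramp s d) = charge_integral nu2 (ramp s d)) ->
  forall A, measurable A -> nu1 A = nu2 A.
Proof.
move=> nu12 A mA.
have [m1 [m1E m1f]] :=
  finite_measure_add (jordan_pos (hahnP nu1)) (jordan_neg (hahnP nu2)).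
have [m2 [m2E m2f]] :=
  finite_measure_add (jordan_pos (hahnP nu2)) (jordan_neg (hahnP nu1)).
have : m1 A = m2 A.
  apply: ramp_measure_unique => // s d d0.
  have vr := vanishing_ramp s d0.
  rewrite m1f// m2f//; have := nu12 s d d0; rewrite /charge_integral => /eqP.
  by rewrite subr_eq addrAC -subr_eq opprK => /eqP.
rewrite m1E m2E /= -!jordan_difference//.
set a := jordan_neg (hahnP nu1) A; set b := jordan_neg (hahnP nu2) A => ab.
have abfin : (a + b)%E \is a fin_num by rewrite fin_numD !fin_num_measure.
rewrite -(addeK (nu1 A) abfin) -(addeK (nu2 A) abfin); congr (_ - _)%E.
by rewrite addeA ab -addeA (addeC b).
Qed.

Lemma charge_regular nu : regular_charge nu.
Proof.
move=> A mA.
apply: (@finite_measure_regular _ (charge_variation (hahnP nu))) => //.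
Qed.

End charges.

(** * Decomposition of functions with a limit at infinity *)

Section clim.
Context {R : realType} {n : nat}.
Local Notation V := 'cV[R]_n.
Implicit Types (f : Rplus R -> R) (x y : Clim R n) (a : V).

Lemma clim_cvg x : x t @[t --> Rplus_infty R] --> clim_lim x.
Proof. by have /clim_predP[_] := clim_funP x. Qed.

Lemma clim_limE x a : x t @[t --> Rplus_infty R] --> a -> clim_lim x = a.
Proof. by move=> xa; apply: cvg_lim => //; exact: norm_hausdorff. Qed.

Lemma const_clim_pred a : (fun=> a) \in @clim_pred R n.
Proof.
apply/clim_predP; split=> [t|]; first exact: (@cvg_cst V a _ (nbhs t)).
by apply/cvg_ex; exists a; exact: (@cvg_cst V a _ (Rplus_infty R)).
Qed.

Definition const_clim a : Clim R n := MkClim (const_clim_pred a).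

Lemma const_clim_lim a : clim_lim (const_clim a) = a.
Proof. by apply: clim_limE; exact: (@cvg_cst V a _ (Rplus_infty R)). Qed.

(** The function [f] placed on the [i]-th coordinate axis; the default value 0
    is only taken when this function is not in the space, which does not happen
    for vanishing [f]. *)
Definition coord_clim i f : Clim R n :=
  insubd (0 : Clim R n) (fun t => f t *: delta_mx i ord0).

Lemma coord_climE i f : vanishing f ->
  coord_clim i f = (fun t => f t *: delta_mx i ord0) :> (Rplus R -> V).
Proof.
move=> [cf fl]; rewrite /coord_clim; apply: insubdK; apply/clim_predP; split.
  move=> t.
  exact: (@cvgZr_tmp _ V _ (nbhs t) _ f _ (delta_mx i ord0) (cf t)).
apply/cvg_ex; eexists.
exact: (@cvgZr_tmp _ V _ (Rplus_infty R) _ f _ (delta_mx i ord0) fl).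
Qed.

Lemma coord_clim_lim i f : vanishing f -> clim_lim (coord_clim i f) = 0.
Proof.
move=> vf; apply: clim_limE; rewrite coord_climE//.
rewrite -[X in _ --> X](scale0r (delta_mx i ord0 : V)).
exact: (@cvgZr_tmp _ V _ (Rplus_infty R) _ f _ (delta_mx i ord0) vf.2).
Qed.

Lemma coord_clim_norm i f c : vanishing f -> (forall t, `|f t| <= c) ->
  `|coord_clim i f| <= c.
Proof.
move=> vf fc; apply: clim_norm_le => t; rewrite coord_climE// normrZ.
rewrite (le_trans _ (fc t))// ler_piMr//.
change (mx_norm (delta_mx i ord0 : V) <= 1).
rewrite mx_normrE; apply: bigmax_le => // j _; rewrite mxE.
by case: (_ && _); rewrite ?normr1 ?normr0.
Qed.

Lemma clim_sumE (k : nat) (y : 'I_k -> Clim R n) t :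
  (\sum_(i < k) y i) t = \sum_(i < k) y i t.
Proof.
by elim/big_rec2 : _ => // i u v _ <-.
Qed.

Lemma coord_vanishing x i : vanishing (fun t => (x t - clim_lim x) i ord0).
Proof.
have /clim_predP[cx _] := clim_funP x.
have cD (F : set_system (Rplus R)) (a : V) : Filter F ->
    x t @[t --> F] --> a ->
    (x t - clim_lim x) i ord0 @[t --> F] --> (a - clim_lim x) i ord0.
  move=> FF xa.
  have xaB : x t - clim_lim x @[t --> F] --> a - clim_lim x.
    exact: (@cvgB _ V _ F _ x (fun=> clim_lim x) _ _ xa (cvg_cst (clim_lim x))).
  exact: (cvg_comp _ _ xaB (@coord_continuous R _ _ i ord0 (a - clim_lim x))).
split=> [t|]; first exact: (cD (nbhs t) _ _ (cx t)).
have -> : 0 = (clim_lim x - clim_lim x) i ord0 by rewrite subrr mxE.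
exact: (cD _ _ _ (clim_cvg (x := x))).
Qed.

(** The splitting of the space on which the proof rests: vanishing coordinates
    plus a constant. *)
Lemma clim_decomposition x :
  x = \sum_(i < n) coord_clim i (fun t => (x t - clim_lim x) i ord0)
      + const_clim (clim_lim x).
Proof.
apply/val_inj/funext => t /=.
rewrite -[LHS](subrK (clim_lim x)) [LHS]/=.
transitivity (\sum_(i < n) coord_clim i (fun t => (x t - clim_lim x) i ord0) t
   + clim_lim x); last by rewrite -clim_sumE.
congr (_ + _); rewrite [LHS](matrix_sum_delta (x t - clim_lim x)).
apply: eq_bigr => i _; rewrite big_ord1 coord_climE//.
exact: coord_vanishing.
Qed.

End clim.

(** * Representation of functionals *)

Section representation.
Context {R : realType} {n : nat}.
Implicit Types (F : {linear Clim R n -> R^o}) (f : Rplus R -> R).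

Lemma const_clim_linear (a : R) (u v : 'cV[R]_n) :
  const_clim (a *: u + v) = a *: const_clim u + const_clim v.
Proof. exact: val_inj. Qed.

Lemma coord_functional_bounded F (i : 'I_n) : continuous F ->
  exists C, bounded_linear C (fun f => F (coord_clim i f)).
Proof.
move=> /linear_bounded_continuous/linear_boundedP[M [_ HM]].
pose C := `|M| + 1.
have FC x : `|F x| <= C * `|x|.
  by apply: HM; rewrite /C (le_lt_trans (ler_norm M))// ltrDl.
exists C; split=> [a f g vf vg|f c vf fc].
  rewrite -linearP; congr (F _); apply: val_inj; apply/funext => t /=.
  have climE h : vanishing h -> coord_clim i h t = h t *: delta_mx i ord0.
    by move=> vh; exact: (congr1 (fun u => u t) (coord_climE i vh)).
  transitivity ((a * f t + g t) *: (delta_mx i ord0 : 'cV[R]_n)).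
    exact: (climE _ (vanishingD (vanishingZ a vf) vg)).
  rewrite scalerDl -scalerA.
  exact: (congr2 (fun u v => a *: u + v)
    (esym (climE _ vf)) (esym (climE _ vg))).
rewrite (le_trans (FC _))// ler_wpM2l//; first by rewrite /C addr_ge0.
exact: coord_clim_norm.
Qed.

Lemma charge_integral0 (nu : {charge set (Rplus R) -> \bar R}) :
  charge_integral nu (fun=> 0) = 0.
Proof. by rewrite /charge_integral !Rintegral_cst// !mul0r subr0. Qed.

Section represents.
Variables (mu : 'I_n -> {charge set (Rplus R) -> \bar R}) (alpha : 'cV[R]_n).
Variable F : {linear Clim R n -> R^o}.

(** A constant function has vanishing part 0, so only [alpha] contributes. *)
Lemma represents_const i : represents mu alpha F ->
  alpha i ord0 = F (const_clim (delta_mx i ord0)).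
Proof.
move=> /(_ (const_clim (delta_mx i ord0)))[-> _]; rewrite const_clim_lim.
rewrite (_ : vector_integral _ _ = 0) ?add0r.
  by rewrite -colE !mxE.
rewrite /vector_integral big1// => j _; rewrite -[RHS](charge_integral0 (mu j)).
by congr charge_integral; apply/funext => t; rewrite /= subrr mxE.
Qed.

(** A function on the [i]-th axis with limit 0 only sees [mu i]. *)
Lemma represents_coord i f : represents mu alpha F -> vanishing f ->
  charge_integral (mu i) f = F (coord_clim i f).
Proof.
move=> /(_ (coord_clim i f))[+ _] vf => ->; rewrite coord_clim_lim//.
rewrite mulmx0 mxE addr0 /vector_integral (bigD1 i)//= big1 ?addr0.
  congr charge_integral; apply/funext => t.
  by rewrite coord_climE// subr0 !mxE !eqxx mulr1.
move=> j /negbTE ji; rewrite -[RHS](charge_integral0 (mu j)).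
congr charge_integral; apply/funext => t.
by rewrite coord_climE// subr0 !mxE ji mulr0.
Qed.

Lemma coord_represents :
  (forall i f, vanishing f -> F (coord_clim i f) = charge_integral (mu i) f) ->
  (forall i, alpha i ord0 = F (const_clim (delta_mx i ord0))) ->
  represents mu alpha F.
Proof.
move=> muF alphaF x; split => //.
rewrite {1}(clim_decomposition x) linearD linear_sum; congr (_ + _).
  apply: eq_bigr => i _; apply: muF; exact: coord_vanishing.
set a := clim_lim x.
have constD (u v : 'cV[R]_n) : const_clim (u + v) = const_clim u + const_clim v.
  by have := const_clim_linear 1 u v; rewrite !scale1r.
have const0 : const_clim (0 : 'cV[R]_n) = 0 by exact: val_inj.
have constZ b (u : 'cV[R]_n) : const_clim (b *: u) = b *: const_clim u.
  by have := const_clim_linear b u 0; rewrite const0 !addr0.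
rewrite {1}(matrix_sum_delta a) (big_morph const_clim constD const0).
rewrite linear_sum mxE; apply: eq_bigr => i _.
by rewrite big_ord1 constZ linearZ/= mxE alphaF mulrC.
Qed.

End represents.

End representation.

Theorem lemma4p2 (R : realType) (n : nat) (n_gt0 : (0 < n)%N)
    (F : {linear Clim R n -> R^o}) (F_continuous : continuous F) :
  exists (mu : 'I_n -> {charge set (Rplus R) -> \bar R}) (alpha : 'cV[R]_n),
    [/\ forall i, regular_charge (mu i),
        represents mu alpha F &
        forall (mu' : 'I_n -> {charge set (Rplus R) -> \bar R})
               (alpha' : 'cV[R]_n),
          (forall i, regular_charge (mu' i)) -> represents mu' alpha' F ->
          (forall i (A : set (Rplus R)), measurable A -> mu' i A = mu i A) /\
          alpha' = alpha].
Proof.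
have /choice[mu muF] (i : 'I_n) :
    exists mu : {charge set (Rplus R) -> \bar R},
    forall f, vanishing f -> F (coord_clim i f) = charge_integral mu f.
  have [C FC] := coord_functional_bounded i F_continuous.
  have [p1 [p2 Fp]] := riesz_vanishing FC.
  exists (cadd (charge_of_finite_measure p1)
    (copp (charge_of_finite_measure p2))).
  by move=> f vf; rewrite Fp// (@charge_integralE _ _ p1 p2).
pose alpha : 'cV[R]_n := \col_i F (const_clim (delta_mx i ord0)).
have muR : represents mu alpha F.
  by apply: coord_represents => // i; rewrite mxE.
exists mu, alpha; split => //; first by move=> i; exact: charge_regular.
move=> mu' alpha' _ muR'; split=> [i A mA|].
  apply: charge_unique => // s d d0.
  by rewrite !(represents_coord _ muR', represents_coord _ muR)//;
     exact: vanishing_ramp.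
apply/matrixP => i j; rewrite ord1.
by rewrite (represents_const _ muR) (represents_const _ muR').
Qed.
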